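(* Let $M$ be an oriented closed connected smooth $3$-manifold and let $\mathcal{L}$ be a riemannian $1$-foliation on $M$. Then every point of $M$ is a recurrence point of $\mathcal{L}$, i.e. for every $x\in M$ one has $x\in\omega(x)$ and $x\in\alpha(x)$.
   Context: A ($1$-dimensional) $1$-foliation $\mathcal{L}$ on $M$ means a nowhere vanishing smooth vector field on $M$; its flow is denoted $\mathcal{L}:\mathbb{R}\times M\to M$, with $\mathcal{L}^t:=\mathcal{L}(t,\cdot)$. Leaves are the orbits of this flow. Limit sets. For $q\in M$, $\omega(q)=\{x\in M: x=\lim_{n\to\infty}\mathcal{L}^{t_n}(q)\text{ for some sequence }t_n\to\infty\}$ and $\alpha(q)=\{x\in M: x=\lim_{n\to\infty}\mathcal{L}^{-t_n}(q)\text{ for some sequence }t_n\to\infty\}$. A point $x$ is a (Poincaré) recurrence point if $x\in\omega(x)$ and $x\in\alpha(x)$. Riemannian $1$-foliation. Let $D_0$ be the open unit disk in $\mathbb{R}^2$. For each $x\in M$ let $\iota_x:(D_0,0)\to(M,x)$ be a smooth embedding whose image $D_x$ is transverse to $\mathcal{L}$, and let $\epsilon_x>0$ be such that $\tilde\iota_x:D_0\times(-\epsilon_x,\epsilon_x)\to M$, $\tilde\iota_x(y,t)=\mathcal{L}^t(\iota_x(y))$, is an open embedding, with image $U_x$. Let $p_x:U_x\to D_0$ be $\tilde\iota_x^{-1}$ followed by the projection to $D_0$. For $x,y\in M$ let $\gamma_{xy}:=p_x\circ\iota_y$, defined on the (possibly empty) open set $\iota_y^{-1}(U_x)\subset D_0$.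 Put $\Gamma:=\{\gamma_{xy}\}_{x,y\in M}$ (the holonomy pseudo-group). $\mathcal{L}$ is called riemannian if there exist such embeddings $\iota_x$ $(x\in M)$ and a riemannian metric on $D_0$ invariant under all the locally defined diffeomorphisms in $\Gamma$. *)

(* Defs.v *)
From HB Require Import structures.
From mathcomp Require Import all_boot all_order all_algebra.
From mathcomp Require Import all_classical all_reals all_analysis.

Set Implicit Arguments.
Unset Strict Implicit.
Unset Printing Implicit Defensive.

Import Order.TTheory GRing.Theory Num.Theory.
Import numFieldNormedType.Exports.

Local Open Scope classical_set_scope.
Local Open Scope ring_scope.

(* Meant for open U only: C^(k+1) on U is "differentiable on U with all
   directional derivatives C^k on U". *)
Fixpoint C_on (R : realType) (V W : normedModType R) (k : nat) (U : set V)
    (f : V -> W) : Prop :=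
  match k with
  | 0 => forall u, U u -> {for u, continuous f}
  | k'.+1 => (forall u, U u -> differentiable f u) /\
             (forall v : V, C_on k' U (fun u => 'D_v f u))
  end.

Definition smooth_on (R : realType) (V W : normedModType R) (U : set V)
    (f : V -> W) : Prop := forall k, C_on k U f.

(* Charts are total functions, meaningful only on their domains: chart i is a
   homeomorphism from dom i onto the open set chart i @` dom i of R^n (so there
   is no boundary), with inverse cinv i. *)
Record atlas (R : realType) (n : nat) (M : topologicalType) := Atlas {
  idx : Type ;
  dom : idx -> set M ;
  chart : idx -> M -> 'rV[R]_n ;
  cinv : idx -> 'rV[R]_n -> M ;
  dom_open : forall i, open (dom i) ;
  dom_cover : forall q, exists i, dom i q ;
  codom_open : forall i, open (chart i @` dom i) ;
  chartK : forall i q, dom i q -> cinv i (chart i q) = q ;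
  chart_continuous : forall i q, dom i q -> {for q, continuous (chart i)} ;
  cinv_continuous : forall i u, (chart i @` dom i) u ->
    {for u, continuous (cinv i)} ;
  transition_smooth : forall i j,
    smooth_on (chart i @` (dom i `&` dom j)) (chart j \o cinv i)
}.

Definition closed_connected_manifold (R : realType) (n : nat)
    (M : topologicalType) (A : atlas R n M) : Prop :=
  [/\ hausdorff_space M, @second_countable M, compact [set: M] &
      connected [set: M]].

(* An orientation is given by an oriented atlas. *)
Definition oriented (R : realType) (n : nat) (M : topologicalType)
    (A : atlas R n M) : Prop :=
  forall (i j : idx A) q, dom i q -> dom j q ->
    0 < \det (jacobian (chart j \o cinv i) (chart i q)).

(* vf i q is the coordinate vector in the chart i of the tangent vector at q. *)
Record vector_field (R : realType) (n : nat) (M : topologicalType)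
    (A : atlas R n M) := VectorField {
  vf : idx A -> M -> 'rV[R]_n ;
  vf_change : forall i j q, dom i q -> dom j q ->
    vf j q = 'd (chart j \o cinv i) (chart i q) (vf i q) ;
  vf_smooth : forall i, smooth_on (chart i @` dom i) (vf i \o cinv i)
}.

Definition nowhere_vanishing (R : realType) (n : nat) (M : topologicalType)
    (A : atlas R n M) (X : vector_field A) : Prop :=
  forall i q, dom i q -> vf X i q != 0.

Section maps_into_manifold.
Context (R : realType) (n : nat) (M : topologicalType) (A : atlas R n M).

(* For open U. *)
Definition smooth_into (V : normedModType R) (U : set V) (f : V -> M) : Prop :=
  (forall u, U u -> {for u, continuous f}) /\
  (forall i : idx A, smooth_on (U `&` f @^-1` dom i) (chart i \o f)).

(* Injective immersion which is a homeomorphism onto its image. *)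
Definition smooth_embedding (V : normedModType R) (U : set V) (f : V -> M) :
    Prop :=
  [/\ smooth_into U f,
      {in U &, injective f},
      (forall (i : idx A) u, U u -> dom i (f u) ->
         injective ('d (chart i \o f) u)) &
      (forall W, open W -> exists O : set M,
         open O /\ f @` (U `&` W) = f @` U `&` O)].

Definition open_embedding (V : normedModType R) (U : set V) (f : V -> M) :
    Prop := smooth_embedding U f /\ open (f @` U).

Definition transverse (X : vector_field A) (V : normedModType R) (U : set V)
    (f : V -> M) : Prop :=
  forall (i : idx A) u, U u -> dom i (f u) ->
    forall w : 'rV[R]_n, exists (v : V) (c : R),
      w = 'd (chart i \o f) u v + c *: vf X i (f u).

End maps_into_manifold.

Arguments smooth_into {R n M} A {V} U f.
Arguments smooth_embedding {R n M} A {V} U f.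
Arguments open_embedding {R n M} A {V} U f.

(* The flow as a smooth map R x M -> M, read in the charts of the factor M. *)
Record is_flow (R : realType) (n : nat) (M : topologicalType)
    (A : atlas R n M) (X : vector_field A) (L : R -> M -> M) : Prop := IsFlow {
  flow0 : forall q, L 0 q = q ;
  flowD : forall s t q, L (s + t) q = L s (L t q) ;
  flow_smooth : forall j : idx A,
    smooth_into A [set z : R * 'rV[R]_n | (chart j @` dom j) z.2]
      (fun z => L z.1 (cinv j z.2)) ;
  flow_derive : forall (i : idx A) q t, dom i (L t q) ->
    is_derive t 1 (fun s => chart i (L s q)) (vf X i (L t q))
}.

(* The norm of 'rV[R]_2 in the library is the sup norm. *)
Definition unit_disk (R : realType) : set 'rV[R]_2 :=
  [set y : 'rV[R]_2 | y 0 0 ^+ 2 + y 0 1 ^+ 2 < 1].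

Definition riemannian_metric (R : realType) (n : nat) (U : set 'rV[R]_n)
    (g : 'rV[R]_n -> 'M[R]_n) : Prop :=
  [/\ smooth_on U g,
      (forall y, U y -> (g y)^T = g y) &
      (forall y, U y -> forall v : 'rV[R]_n, v != 0 ->
         0 < (v *m g y *m v^T) 0 0)].

Section riemannian_foliation.
Context (R : realType) (M : topologicalType) (L : R -> M -> M).
Context (iota : M -> 'rV[R]_2 -> M) (eps : M -> R).

Definition box (x : M) : set ('rV[R]_2 * R) :=
  [set z : 'rV[R]_2 * R | unit_disk z.1 /\ - eps x < z.2 < eps x].

Definition iota_tilde (x : M) (z : 'rV[R]_2 * R) : M := L z.2 (iota x z.1).

Definition flow_box (x : M) : set M := iota_tilde x @` box x.

Definition flow_box_proj (x q : M) : 'rV[R]_2 :=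
  ('pinv_(fun=> 0) (box x) (iota_tilde x) q).1.

Definition holonomy (x y : M) : 'rV[R]_2 -> 'rV[R]_2 :=
  flow_box_proj x \o iota y.

Definition holonomy_dom (x y : M) : set 'rV[R]_2 :=
  @unit_disk R `&` iota y @^-1` flow_box x.

Definition holonomy_invariant (g : 'rV[R]_2 -> 'M[R]_2) : Prop :=
  forall x y u, holonomy_dom x y u -> forall v w : 'rV[R]_2,
    'd (holonomy x y) u v *m g (holonomy x y u) *m ('d (holonomy x y) u w)^T =
    v *m g u *m w^T.

End riemannian_foliation.

Definition riemannian (R : realType) (M : topologicalType)
    (A : atlas R 3 M) (X : vector_field A) (L : R -> M -> M) : Prop :=
  exists (iota : M -> 'rV[R]_2 -> M) (eps : M -> R) (g : 'rV[R]_2 -> 'M[R]_2),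
    [/\ (forall x, [/\ iota x 0 = x,
           smooth_embedding A (@unit_disk R) (iota x),
           transverse X (@unit_disk R) (iota x),
           0 < eps x &
           open_embedding A (box eps x) (iota_tilde L iota x)]),
        riemannian_metric (@unit_disk R) g &
        holonomy_invariant L iota eps g].

Definition omega_limit (R : realType) (M : topologicalType) (L : R -> M -> M)
    (q : M) : set M :=
  [set x | exists t : nat -> R,
     t @ \oo --> +oo /\ (fun n => L (t n) q) @ \oo --> x].

Definition alpha_limit (R : realType) (M : topologicalType) (L : R -> M -> M)
    (q : M) : set M :=
  [set x | exists t : nat -> R,
     t @ \oo --> +oo /\ (fun n => L (- t n) q) @ \oo --> x].

Definition recurrence_point (R : realType) (M : topologicalType)
    (L : R -> M -> M) (x : M) : Prop :=
  omega_limit L x x /\ alpha_limit L x x.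

(* Main.v *)
Require Import Defs.
From HB Require Import structures.
From mathcomp Require Import all_boot all_order all_algebra.
From mathcomp Require Import all_classical all_reals all_analysis.
From mathcomp Require Import ring lra.

Set Implicit Arguments.
Unset Strict Implicit.
Unset Printing Implicit Defensive.

Import Order.TTheory GRing.Theory Num.Theory.
Import numFieldNormedType.Exports.

Local Open Scope classical_set_scope.
Local Open Scope ring_scope.

(** Transport along a riemannian flow is isometric in the transverse direction, and
on a compact manifold it is defined on transverse balls of a fixed size, however long
the orbits are followed. Recurrence follows from this equicontinuity.

Infinitesimally, let h be the map which sends u in the disk at y to the transverse
coordinate, in the flow box at x, of [L t (iota y u)]. Its differential preserves
the metric ([flow_holonomy_isometric]). Indeed the length it gives to a vector does
not depend on the box in which the endpoint is read, since two boxes are compared by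
elements of the pseudo-group through the disk at the endpoint ([speed_rebase]); it is
locally constant in t, since moving inside a box changes the time coordinate only
([flow_holonomy_time]); and for t = 0 it is the invariance under the pseudo-group.
Along the way the box coordinates have to be differentiable, which follows from the
injective differentials of the flow boxes ([differentiable_lift]).

For the uniform size, finitely many flow boxes have cores that cover M. On the
compact part of the disk the metric is comparable with the norm, so every isometric
map has a Lipschitz constant K that does not depend on the length of the orbits
([isometry_bound], [pullback_lipschitz]). By compactness a flow step of duration 1
tolerates a transverse displacement k which is the same everywhere
([uniform_steps]); hence balls of radius r with K r < k can be carried through any
number of steps ([pullback_chain]).

Finally let e be 1 or -1 and consider the points [L (e * n) x]. Infinitely many of
them lie in one core with transverse coordinates that cluster, so there are k and
arbitrarily large m for which the coordinates of the points k and m differ by less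
than a prescribed rho. Carrying the point m along the orbit segment from k back to 0
yields a point of the orbit of x in the disk at x at distance at most K rho from x,
at a time [e * m] up to an error that depends on k only ([orbit_return]). The sign 1
gives recurrence in the future and -1 in the past. *)

(** * First-order expansions and lifts *)

Section DifferentiableLift.
Context (R : realType).

Lemma near_center (V : normedModType R) (a : V) (P : V -> Prop) :
  (\forall h \near 0, P h) <-> \forall x \near a, P (x - a).
Proof.
split=> h; last by rewrite (near_shift a) sub0r; exact: filterS h.
rewrite (near_shift 0) subr0.
by apply: filterS h => x /=; rewrite addrK.
Qed.

Let centerE (V W : normedModType R) (f : V -> W) (a x : V) (D : V -> W) :
  (f \o shift a - (cst (f a) + D)) (x - a) = f x - f a - D (x - a).
Proof.
by rewrite -[LHS]/(f (x - a + a) - (f a + D (x - a))) subrK opprD addrA.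
Qed.

Lemma differentiable_bound (V W : normedModType R) (f : V -> W) (a : V) :
  differentiable f a -> forall e : R, 0 < e ->
  \forall x \near a, `|f x - f a - 'd f a (x - a)| <= e * `|x - a|.
Proof.
move=> /diff_locallyP[_ /eqaddoP fa] e e0.
have /(near_center a) := fa e e0.
by apply: filterS => x; rewrite centerE.
Qed.

Lemma bound_is_diff (V W : normedModType R) (f : V -> W) (a : V)
    (D : {linear V -> W}) : continuous D ->
  (forall e : R, 0 < e ->
     \forall x \near a, `|f x - f a - D (x - a)| <= e * `|x - a|) ->
  is_diff a f D.
Proof.
move=> cD fa; have fE : f \o shift a = cst (f a) + D +o_ 0 id.
  apply/eqaddoP => e e0; apply/(near_center a).
  by have := fa e e0; apply: filterS => x; rewrite centerE.
have dfE := diff_unique cD fE.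
by apply: DiffDef => //; apply/diff_locallyP; rewrite dfE.
Qed.

Lemma near_eq_is_diff (V W : normedModType R) (f h : V -> W) (a : V) :
  (\forall x \near a, f x = h x) -> differentiable f a -> is_diff a h ('d f a).
Proof.
move=> fh df; have fha := nbhs_singleton fh.
apply: bound_is_diff => [|e e0]; first exact: diff_continuous.
by apply: filterS2 fh (differentiable_bound df e0) => x <-; rewrite -fha.
Qed.

(** Near [Phi u] the map F differs from a translation by o of the displacement, so
a continuous Phi has the first-order expansion of [F \o Phi]. Only continuity of
Phi is needed beforehand, as in the differentiation of an inverse function. *)
Lemma differentiable_lift_id (U V : normedModType R) (F : V -> V)
    (Phi : U -> V) (u : U) :
  differentiable F (Phi u) -> 'd F (Phi u) = id :> (V -> V) ->
  {for u, continuous Phi} -> differentiable (F \o Phi) u ->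
  differentiable Phi u.
Proof.
move=> dF dFid cPhi dG.
have cdG := diff_continuous dG.
have [k k0 kP] := linear_lipschitz cdG.
suff : is_diff u Phi ('d (F \o Phi) u) by move=> [].
apply: (bound_is_diff cdG) => e e0.
have Fnear (d : R) : 0 < d -> \forall x \near u,
      `|F (Phi x) - F (Phi u) - (Phi x - Phi u)| <= d * `|Phi x - Phi u|.
  move=> d0; have := differentiable_bound dF d0; rewrite dFid.
  exact: cPhi.
(* At least half of any displacement of Phi shows in F \o Phi. *)
have lip : \forall x \near u, `|Phi x - Phi u| <= 2 * (k + 1) * `|x - u|.
  have h2 : (0 : R) < 2^-1 by rewrite invr_gt0.
  near=> x.
  have h1 : `|F (Phi x) - F (Phi u) - (Phi x - Phi u)| <=
      2^-1 * `|Phi x - Phi u|.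
    by near: x; exact: Fnear.
  have h3 : `|(F \o Phi) x - (F \o Phi) u - 'd (F \o Phi) u (x - u)| <=
      1 * `|x - u|.
    by near: x; exact: differentiable_bound.
  have := kP (x - u).
  have := lerB_dist (Phi x - Phi u) (F (Phi x) - F (Phi u)).
  rewrite (distrC (Phi x - Phi u) (F (Phi x) - F (Phi u))).
  have := lerB_dist ((F \o Phi) x - (F \o Phi) u) ('d (F \o Phi) u (x - u)).
  move: h1 h3; rewrite /=; lra.
near=> x.
have h1 : `|F (Phi x) - F (Phi u) - (Phi x - Phi u)|
    <= e / (4 * (k + 1)) * `|Phi x - Phi u|.
  by near: x; apply: Fnear; rewrite divr_gt0// mulr_gt0//; lra.
have h2 : `|Phi x - Phi u| <= 2 * (k + 1) * `|x - u| by near: x.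
have h3 : `|(F \o Phi) x - (F \o Phi) u - 'd (F \o Phi) u (x - u)| <=
    e / 2 * `|x - u|.
  by near: x; apply: differentiable_bound => //; rewrite divr_gt0.
have h4 : `|F (Phi x) - F (Phi u) - (Phi x - Phi u)| <= e / 2 * `|x - u|.
  apply: (le_trans h1).
  have -> : e / 2 * `|x - u| = e / (4 * (k + 1)) * (2 * (k + 1) * `|x - u|).
    by field; rewrite gt_eqF// addr_gt0.
  by rewrite ler_wpM2l// divr_ge0//; lra.
have := ler_distD (F (Phi x) - F (Phi u)) (Phi x - Phi u)
  ('d (F \o Phi) u (x - u) : V).
rewrite (distrC (Phi x - Phi u) (F (Phi x) - F (Phi u))).
move: h3 h4; rewrite /=; lra.
Unshelve. all: by end_near. Qed.
End DifferentiableLift.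

Section SplitRow.
Context (R : realType).

Lemma rV_linear_continuous (V : normedModType R) n
  (f : {linear 'rV[R]_n -> V}) : continuous f.
Proof.
move=> x; apply: differentiable_continuous.
have -> : f = \sum_(i < n) (fun w : 'rV[R]_n => w 0 i *: f (delta_mx 0 i))
    :> ('rV[R]_n -> V).
  apply/funext => w; rewrite fct_sumE {1}(row_sum_delta w) linear_sum.
  by apply: eq_bigr => i _; rewrite linearZ.
apply: differentiable_sum => i.
exact/differentiableZl/differentiable_coord.
Qed.

Definition split_row m (w : 'rV[R]_(m + 1)) : 'rV[R]_m * R :=
  (lsubmx w, rsubmx w 0 0).

Fact split_row_linear m : linear (@split_row m).
Proof. by move=> a u v; rewrite /split_row !linearP !mxE. Qed.

HB.instance Definition _ m := @GRing.isLinear.Build R 'rV[R]_(m + 1)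
  ('rV[R]_m * R)%type _ (@split_row m) (@split_row_linear m).

Lemma split_row_mx m (z : 'rV[R]_m * R) :
  split_row (row_mx z.1 (const_mx z.2)) = z.
Proof. by rewrite /split_row row_mxKl row_mxKr mxE -surjective_pairing. Qed.

(** A transverse disk times a time interval and a chart have the same dimension, so
an injective differential has a linear inverse; composing F with it reduces to the
case where the differential is the identity. *)
Lemma differentiable_lift (U : normedModType R) m
    (F : 'rV[R]_m * R -> 'rV[R]_(m + 1)) (Phi : U -> 'rV[R]_m * R) (u : U) :
  differentiable F (Phi u) -> injective ('d F (Phi u)) ->
  {for u, continuous Phi} -> differentiable (F \o Phi) u ->
  differentiable Phi u.
Proof.
move=> dF injF cPhi dG.
pose N := lin1_mx ('d F (Phi u) \o @split_row m).
have NE w : w *m N = 'd F (Phi u) (split_row w) by rewrite mul_rV_lin1.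
have /row_freeP[P NP] : row_free N.
  apply: inj_row_free => w; rewrite NE => w0.
  have /injF h : 'd F (Phi u) (split_row w) = 'd F (Phi u) 0.
    by rewrite w0 linear0.
  rewrite -[w]hsubmxK; move: h => /pair_equal_spec[-> h].
  by rewrite (_ : rsubmx w = 0) ?row_mx0//; apply/rowP => i; rewrite ord1 h mxE.
pose B := (@split_row m \o mulmxr P).
have cB : continuous B by exact: rV_linear_continuous.
have dB x : differentiable B x by exact: linear_differentiable.
apply: (@differentiable_lift_id R U _ (B \o F)) => //.
- exact: differentiable_comp.
- rewrite diff_comp//; apply/funext => v /=; rewrite diff_lin//.
  rewrite /B /= -{1}(split_row_mx v) -NE -mulmxA NP mulmx1.
  exact: split_row_mx.
- by rewrite -compA; apply: differentiable_comp.
Qed.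
End SplitRow.

(** * Mean value inequality and comparison of metrics *)

Section MeanValue.
Context (R : realType).

Lemma rV_norm_le n (v : 'rV[R]_n) (c : R) : 0 <= c ->
  (`|v| <= c) <-> (forall j, `|v 0 j| <= c).
Proof.
move=> c0; rewrite -[`|v|]/(mx_norm v) /mx_norm.
have -> : c = (NngNum c0)%:num by [].
rewrite num_le; split.
  by move=> /bigmax_leP[_ h] j; have := h (0, j) isT; rewrite -num_le.
move=> h; apply/bigmax_leP; split; first by rewrite -num_le.
by move=> [i j] _; rewrite -num_le /= ord1.
Qed.

Lemma coord_norm_le n (v : 'rV[R]_n) j : `|v 0 j| <= `|v|.
Proof. exact: (rV_norm_le v (normr_ge0 v)).1. Qed.

Lemma diff_coord n (v : 'rV[R]_n) j :
  'd (fun w : 'rV[R]_n => w 0 j : R) v = (fun w => w 0 j) :> (_ -> _).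
Proof.
pose c (w : 'rV[R]_n) : R := w 0 j.
have clin : linear c by move=> k x y; rewrite /c !mxE.
pose cM := GRing.isLinear.Build _ _ _ _ _ clin.
pose cL : {linear 'rV[R]_n -> R} := HB.pack c cM.
rewrite -[LHS]/('d cL v : _ -> _) diff_lin//.
exact: (@coord_continuous R 1 n 0 j).
Qed.

Lemma mean_value (V : normedModType R) m (H : V -> 'rV[R]_m) (a b : V) (k : R) :
  0 <= k ->
  (forall s : R, 0 <= s <= 1 -> differentiable H (a + s *: (b - a)) /\
     `|'d H (a + s *: (b - a)) (b - a)| <= k) ->
  `|H b - H a| <= k.
Proof.
move=> k0 dH; apply/rV_norm_le => // j.
pose c (s : R) : V := a + s *: (b - a).
pose f (s : R) : R := H (c s) 0 j.
pose df (s : R) : R := 'd H (c s) (b - a) 0 j.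
have fder (s : R) : 0 <= s <= 1 -> is_derive s 1 f (df s).
  move=> /dH[dHs _].
  have cs : is_diff s c (0 + *:%R ^~ (b - a)) by exact: is_diffD.
  have dHc : differentiable (H \o c) s by exact: differentiable_comp.
  have dcoord := differentiable_coord (H (c s)) 0 j.
  have dfs : differentiable f s := differentiable_comp dHc dcoord.
  split; first exact: diff_derivable.
  rewrite deriveE// (diff_comp dHc dcoord) /= diff_coord diff_comp//=.
  by rewrite diff_val !fctE /= add0r scale1r.
have [x] : exists2 x, x \in `[0, 1]%R & f 1 - f 0 = df x * (1 - 0).
  apply: MVT_segment => // [x|].
    by rewrite in_itv/= => /andP[? ?]; apply: fder; rewrite !ltW.
  apply: derivable_within_continuous => x; rewrite in_itv/= => x01.
  by have [] := fder x x01.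
rewrite in_itv /= => /dH[_ le]; rewrite /f /c scale1r scale0r addr0 (addrC a) subrK.
rewrite subr0 mulr1 => fE; rewrite 2!mxE fE.
exact: (le_trans (coord_norm_le _ _)).
Qed.
End MeanValue.

Section MetricBound.
Context (R : realType).

Lemma closed_ball_rV_compact n (r : R) :
  compact [set v : 'rV[R]_n | `|v| <= r].
Proof.
apply: bounded_closed_compact.
  exists r; split; first exact: num_real.
  by move=> M rM v /= /le_trans; apply; exact: ltW.
rewrite -/((@Num.norm R 'rV[R]_n) @^-1` [set x | x <= r]).
by apply: (preimage_closed _ (@closed_le _ _)) => v _; exact: norm_continuous.
Qed.

Lemma sphere_rV_compact n : compact [set v : 'rV[R]_n | `|v| = 1].
Proof.
apply: bounded_closed_compact.
  by exists 1; split; [exact: num_real|move=> M rM v /= ->; exact: ltW].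
rewrite -/((@Num.norm R 'rV[R]_n) @^-1` [set x | x = 1]).
by apply: (preimage_closed _ (@closed_eq _ _)) => v _; exact: norm_continuous.
Qed.

(** The squared length of the tangent vector v at w. *)
Definition metric_sq n (g : 'rV[R]_n -> 'M[R]_n) (w v : 'rV[R]_n) : R :=
  (v *m g w *m v^T) 0 0.

Lemma metric_sq_continuous n (g : 'rV[R]_n -> 'M[R]_n) w v :
  {for w, continuous g} ->
  {for (w, v), continuous (fun z : 'rV[R]_n * 'rV[R]_n =>
     metric_sq g z.1 z.2)}.
Proof.
move=> cg.
pose q (z : 'rV[R]_n * 'rV[R]_n) : R :=
  \sum_(j < n) (\sum_(i < n) z.2 0 i * g z.1 i j) * z.2 0 j.
have qE : (fun z : 'rV[R]_n * 'rV[R]_n => metric_sq g z.1 z.2) = q.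
  rewrite /metric_sq; apply/funext => z; rewrite mxE.
  by apply: eq_bigr => j _; rewrite !mxE.
rewrite qE /prop_for /continuous_at /q.
apply: cvg_big => [|j _]; first exact: add_continuous.
apply: cvgM; last first.
  apply: (cvg_comp snd (fun x : 'rV[R]_n => x 0 j)); first exact: cvg_snd.
  exact: coord_continuous.
apply: cvg_big => [|i _]; first exact: add_continuous.
apply: cvgM.
  apply: (cvg_comp snd (fun x : 'rV[R]_n => x 0 i)); first exact: cvg_snd.
  exact: coord_continuous.
apply: (cvg_comp fst (fun x => g x i j)); first exact: cvg_fst.
apply: (cvg_comp g (fun x : 'M[R]_n => x i j)); [exact: cg|exact: coord_continuous].
Qed.

(** Over a compact set the metric is squeezed between two multiples of the norm, so
all linear isometries between its points share one operator bound. This bound is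
insensitive to how the isometry was obtained, in particular to how many holonomy
maps were composed. *)
Lemma isometry_bound n (U C : set 'rV[R]_n) (g : 'rV[R]_n -> 'M[R]_n) :
  compact C -> C `<=` U -> riemannian_metric U g ->
  exists K : R, 0 <= K /\ forall w w' v v', C w -> C w' ->
    metric_sq g w' v' = metric_sq g w v -> `|v'| <= K * `|v|.
Proof.
move=> cC CU [sg _ pg].
pose q (z : 'rV[R]_n * 'rV[R]_n) := metric_sq g z.1 z.2.
pose S := C `*` [set v : 'rV[R]_n | `|v| = 1].
have cS : compact S by exact/compact_setX/sphere_rV_compact.
have Sunit w v : C w -> v != 0 -> S (w, `|v|^-1 *: v).
  move=> Cw v0; split => //=; rewrite normrZ normfV normr_id mulVf//.
  by rewrite normr_eq0.
have cq : {within S, continuous q}.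
  apply: continuous_in_subspaceT => -[w v]; rewrite inE => -[/= /CU Uw _].
  apply: (@metric_sq_continuous n g w v); exact: (sg 0%N w Uw).
have qhom w v : q (w, v) = `|v| ^+ 2 * q (w, `|v|^-1 *: v).
  have [->|v0] := eqVneq v 0.
    by rewrite /q /metric_sq /= normr0 expr0n !mul0mx mxE mul0r.
  rewrite /q /metric_sq /= -!scalemxAl linearZ /= -scalemxAr scalerA.
  rewrite [in RHS]mxE mulrA -expr2 -exprMn divff ?normr_eq0//.
  by rewrite expr1n mul1r.
have [S0|/set0P/negP/negPn/eqP S0] := pselect (S !=set0); last first.
  (* No unit tangent vector at all over C: then v' vanishes. *)
  exists 0; split => // w w' v v' Cw Cw' _; rewrite mul0r normr_le0.
  apply/negPn/negP => /(Sunit _ _ Cw'); by rewrite S0.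
have [[w0 v0] /set_mem[/= Cw0 v01] qmin] := compact_EVT_min S0 cS cq.
have [[w1 v1] /set_mem[/= Cw1 v11] qmax] := compact_EVT_max S0 cS cq.
have m0 : 0 < q (w0, v0).
  by apply: pg; [exact: CU|rewrite -normr_eq0 v01 oner_eq0].
exists (Num.sqrt (q (w1, v1) / q (w0, v0))); split; first exact: sqrtr_ge0.
move=> w w' v v' Cw Cw' qE.
have lo : `|v'| ^+ 2 * q (w0, v0) <= q (w', v').
  have [->|v'0] := eqVneq v' 0.
    by rewrite normr0 expr0n mul0r /q /metric_sq /= !mul0mx mxE.
  by rewrite qhom ler_wpM2l ?sqr_ge0//; apply: qmin; exact/mem_set/Sunit.
have hi : q (w, v) <= `|v| ^+ 2 * q (w1, v1).
  have [->|v0'] := eqVneq v 0.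
    by rewrite normr0 expr0n mul0r /q /metric_sq /= !mul0mx mxE.
  by rewrite qhom ler_wpM2l ?sqr_ge0//; apply: qmax; exact/mem_set/Sunit.
rewrite -(ger0_norm (normr_ge0 v)) -sqrtr_sqr -sqrtrM; last first.
  rewrite divr_ge0 ?(ltW m0)// (le_trans (ltW m0))//.
  by apply: qmin; exact: mem_set.
rewrite -(ger0_norm (normr_ge0 v')) -sqrtr_sqr ler_wsqrtr//.
rewrite mulrAC ler_pdivlMr// (le_trans lo)// /q /= qE (le_trans hi)//.
by rewrite mulrC.
Qed.
End MetricBound.

(** * Clustering of labelled sequences *)

Section Pigeonhole.
Context (R : realType).

(** The label is recorded as a real number, so that one cluster point of the pairs
(label, point) controls both: labels at distance less than 1 are equal. *)
Lemma labelled_pigeonhole (I : eqType) d (s : seq I) (c : nat -> I)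
    (w : nat -> 'rV[R]_d) (b r : R) :
  0 < r -> (forall n, c n \in s) -> (forall n, `|w n| <= b) ->
  exists k, forall n0, exists m, [/\ (n0 <= m)%N, c m = c k & `|w m - w k| < r].
Proof.
move=> r0 cs wb.
pose u n : R * 'rV[R]_d := ((index (c n) s)%:R, w n).
pose K : set (R * 'rV[R]_d) :=
  `[0, (size s)%:R]%classic `*` [set v : 'rV[R]_d | `|v| <= b].
have cK : compact K.
  by apply: compact_setX; [exact: segment_compact|exact: closed_ball_rV_compact].
have [|p [_ clp]] := cK (u @ \oo) _.
  by exists 0%N => // n _; split => //=; rewrite in_itv/= ler0n ler_nat index_size.
pose e := Num.min (1 / 2) (r / 2).
have e0 : 0 < e by rewrite lt_min divr_gt0//=; lra.
have near n0 : exists2 m, (n0 <= m)%N & ball p e (u m).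
  have [] := clp (u @` [set m | (n0 <= m)%N]) (ball p e).
  - by exists n0 => // n /= nn; exists n.
  - exact: nbhsx_ballx.
  - by move=> _ [[m /= nm <-] pm]; exists m.
have [k _ pk] := near 0%N.
exists k => n0; have [m nm pm] := near n0; exists m.
move: pk pm => [/= pk1 pk2] [/= pm1 pm2].
have e1 : e <= 1 / 2 by rewrite ge_min lexx.
have e2 : e <= r / 2 by rewrite ge_min lexx orbT.
split => //.
- move: pk1 pm1; rewrite -!ball_normE /= => pk1 pm1.
  have : `|(index (c m) s)%:R - (index (c k) s)%:R : R| < 1.
    have := ler_distD p.1 (index (c m) s)%:R (index (c k) s)%:R.
    rewrite (distrC _ p.1); lra.
  rewrite ltr_norml => /andP[lo hi].
  have ckm : index (c m) s = index (c k) s.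
    have h1 : ((index (c m) s)%:R < (index (c k) s).+1%:R :> R).
      by rewrite -natr1; lra.
    have h2 : ((index (c k) s)%:R < (index (c m) s).+1%:R :> R).
      by rewrite -natr1; lra.
    move: h1 h2; rewrite !ltr_nat !ltnS => h1 h2.
    by apply/eqP; rewrite eqn_leq h1.
  by rewrite -[LHS](nth_index (c 0%N) (cs m)) ckm nth_index.
- move: pk2 pm2; rewrite -!ball_normE /= => pk2 pm2.
  have := ler_distD p.2 (w m) (w k); rewrite (distrC (w m) p.2); lra.
Qed.
End Pigeonhole.

Lemma continuous_fst (V W : topologicalType) : continuous (@fst V W).
Proof. by move=> [a b]; exact: cvg_fst. Qed.

Lemma continuous_snd (V W : topologicalType) : continuous (@snd V W).
Proof. by move=> [a b]; exact: cvg_snd. Qed.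

(** * Coordinates in flow boxes *)

Section FlowBoxes.
Context (R : realType) (M : topologicalType) (A : atlas R 3 M)
  (X : vector_field A) (L : R -> M -> M) (hL : is_flow X L)
  (iota : M -> 'rV[R]_2 -> M) (eps : M -> R)
  (hiota : forall x, [/\ iota x 0 = x,
           smooth_embedding A (@unit_disk R) (iota x),
           transverse X (@unit_disk R) (iota x),
           0 < eps x &
           open_embedding A (box eps x) (iota_tilde L iota x)]).

Local Notation T := (iota_tilde L iota).
Local Notation U := (flow_box L iota eps).
Local Notation B := (box eps).
Local Notation D := (@unit_disk R).

Definition box_coord (x q : M) : 'rV[R]_2 * R :=
  'pinv_(fun=> 0) (box eps x) (iota_tilde L iota x) q.

Local Notation phi := box_coord.

Lemma disk0 : D 0.
Proof. by rewrite /unit_disk /= !mxE expr0n addr0 ltr01. Qed.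

Lemma iota0 x : iota x 0 = x. Proof. by case: (hiota x). Qed.

Lemma eps_gt0 x : 0 < eps x. Proof. by case: (hiota x). Qed.

Lemma iota_continuous x u : D u -> {for u, continuous (iota x)}.
Proof. by case: (hiota x) => _ [[h _] _ _ _] _ _ _; exact: h. Qed.

Lemma iota_tilde_continuous x z : B x z -> {for z, continuous (T x)}.
Proof. by case: (hiota x) => _ _ _ _ [[[h _] _ _ _] _]; exact: h. Qed.

Lemma iota_tilde_inj x : {in B x &, injective (T x)}.
Proof. by case: (hiota x) => _ _ _ _ [[_ h _ _] _]. Qed.

Lemma flow_box_open x : open (U x).
Proof. by case: (hiota x) => _ _ _ _ [_]. Qed.

Lemma box_coordK x z : B x z -> phi x (T x z) = z.
Proof. by move=> Bz; apply: pinvKV; [exact: iota_tilde_inj|exact/mem_set]. Qed.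

Lemma flow_box_coord x q : U x q -> B x (phi x q).
Proof. by move=> [z Bz <-]; rewrite box_coordK. Qed.

Lemma box_coordKV x q : U x q -> T x (phi x q) = q.
Proof. by move=> [z Bz <-]; rewrite box_coordK. Qed.

Lemma flow_box_near x q : U x q -> \forall q' \near q, U x q'.
Proof. by move=> Uq; apply: open_nbhs_nbhs; split => //; exact: flow_box_open. Qed.

(** This is where the flow box is required to be an embedding and not only a
continuous injection. *)
Lemma box_coord_continuous x q : U x q -> {for q, continuous (phi x)}.
Proof.
move=> Uq W; rewrite nbhsE => -[V [oV Vq] VW].
have [_ _ _ _ [[_ _ _ hemb] _]] := hiota x.
have [N [oN NE]] := hemb V oV.
have Nq : N q.
  suff : (U x `&` N) q by case.
  rewrite -NE; exists (phi x q); last exact: box_coordKV.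
  by split => //; exact: flow_box_coord.
have : nbhs q (U x `&` N).
  by apply: filterI; [exact: flow_box_near|exact: open_nbhs_nbhs].
apply: filterS; rewrite -NE => _ [z [Bz Vz] <-] /=.
by rewrite box_coordK//; exact: VW.
Qed.

Lemma flow_continuous t : continuous (L t).
Proof.
move=> q; have [j dq] := dom_cover A q.
have [h _] := flow_smooth hL j.
have hc : {for (t, chart j q),
    continuous (fun z : R * 'rV[R]_3 => L z.1 (cinv j z.2))}.
  by apply: h; exists q.
have : (fun q' => L t (cinv j (chart j q'))) @ q --> L t q.
  rewrite -{2}(chartK dq).
  apply: (cvg_comp (fun q' => (t, chart j q'))
    (fun z : R * 'rV[R]_3 => L z.1 (cinv j z.2))); last exact: hc.
  have ht : (fun=> t) @ q --> t by exact: cvg_cst.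
  have hj : chart j @ q --> chart j q by exact: chart_continuous.
  exact: (cvg_pair ht hj).
apply: cvg_trans; apply: near_eq_cvg.
have : nbhs q (dom j) by apply: open_nbhs_nbhs; split => //; exact: dom_open.
by apply: filterS => q' dq'; rewrite chartK.
Qed.

Lemma flowK t q : L (- t) (L t q) = q.
Proof. by rewrite -(flowD hL) addNr (flow0 hL). Qed.

Lemma flow_iota_tilde r x z : L r (T x z) = T x (z.1, z.2 + r).
Proof. by rewrite /iota_tilde /= -(flowD hL) addrC. Qed.

Lemma iota_tilde0 x u : T x (u, 0) = iota x u.
Proof. by rewrite /iota_tilde /= (flow0 hL). Qed.

Lemma box_coord_flow x q r : U x q -> - eps x < (phi x q).2 + r < eps x ->
  U x (L r q) /\ phi x (L r q) = ((phi x q).1, (phi x q).2 + r).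
Proof.
move=> Uq hr; have [Dq _] := flow_box_coord Uq.
have Bq : B x ((phi x q).1, (phi x q).2 + r) by split.
rewrite -{1 2}(box_coordKV Uq) flow_iota_tilde; split.
  by exists ((phi x q).1, (phi x q).2 + r).
exact: box_coordK.
Qed.

Lemma iota_flow_box x u : D u -> U x (iota x u).
Proof.
move=> Du; exists (u, 0); last exact: iota_tilde0.
by split => //=; rewrite oppr_lt0 !eps_gt0.
Qed.

Lemma box_coord_iota x u : D u -> phi x (iota x u) = (u, 0).
Proof.
move=> Du; rewrite -iota_tilde0 box_coordK//.
by split => //=; rewrite oppr_lt0 !eps_gt0.
Qed.

Lemma self_flow_box x : U x x.
Proof. by rewrite -{2}(iota0 x); apply: iota_flow_box; exact: disk0. Qed.

Lemma box_coord_self x : phi x x = 0.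
Proof. by rewrite -{2}(iota0 x) box_coord_iota//; exact: disk0. Qed.

Definition transport (x : M) (t : R) (y : M) (u : 'rV[R]_2) : 'rV[R]_2 * R :=
  box_coord x (L t (iota y u)).

Lemma transport_continuous x t y u : D u -> U x (L t (iota y u)) ->
  {for u, continuous (transport x t y)}.
Proof.
move=> Du Uu.
apply: (cvg_comp (iota y) (fun q => phi x (L t q))).
  exact: iota_continuous.
apply: (cvg_comp (L t) (phi x)); first exact: flow_continuous.
exact: box_coord_continuous.
Qed.

Lemma flow_iota_near x t y u : D u -> U x (L t (iota y u)) ->
  \forall u' \near u, U x (L t (iota y u')).
Proof.
move=> Du Uu.
have := flow_continuous (flow_box_near Uu).
exact: (iota_continuous Du).
Qed.

Lemma flow_iota_differentiable (i : idx A) t y u : D u -> dom i (L t (iota y u)) ->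
  differentiable (fun u' => chart i (L t (iota y u'))) u.
Proof.
move=> Du di; have [j dj] := dom_cover A (iota y u).
have [_ [[_ hsm] _ _ _] _ _ _] := hiota y.
have [dj_iota _] := hsm j 1%N.
have [_ hfl] := flow_smooth hL j; have [dflow _] := hfl i 1%N.
have dcj : differentiable (fun u' => (t, chart j (iota y u'))) u.
  by apply: differentiable_pair => //; apply: dj_iota.
have dcomp := differentiable_comp dcj (dflow (t, chart j (iota y u)) _).
have : differentiable
   ((chart i \o (fun z : R * 'rV[R]_3 => L z.1 (cinv j z.2))) \o
   (fun u' => (t, chart j (iota y u')))) u.
  by apply: dcomp; split => /=; [exists (iota y u)|rewrite chartK].
have djn : nbhs (iota y u) (dom j).
  by apply: open_nbhs_nbhs; split => //; exact: dom_open.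
have hn : \forall u' \near u, dom j (iota y u') := iota_continuous Du djn.
suff hE : \forall u' \near u, chart i (L t (cinv j (chart j (iota y u')))) =
    chart i (L t (iota y u')) by move=> /(near_eq_is_diff hE)[].
by apply: filterS hn => u' /= /chartK ->.
Qed.

(** The box coordinates are an inverse map whose smoothness is not part of the
data; it comes from the injective differential of the flow box. *)
Lemma transport_differentiable x t y u : D u -> U x (L t (iota y u)) ->
  differentiable (transport x t y) u.
Proof.
move=> Du Uu; have [i di] := dom_cover A (L t (iota y u)).
have [_ _ _ _ [[[_ hsm] _ hinj _] _]] := hiota x.
have [dF _] := hsm i 1%N.
have Bu := flow_box_coord Uu.
have diT : dom i (T x (phi x (L t (iota y u)))) by rewrite box_coordKV.
apply: (@differentiable_lift R _ 2 (chart i \o T x)).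
- by apply: dF; split.
- exact: hinj.
- exact: transport_continuous.
- have := flow_iota_differentiable Du di.
  suff hE : \forall u' \near u, chart i (L t (iota y u')) =
    (chart i \o T x) (transport x t y u') by move=> /(near_eq_is_diff hE)[].
  apply: filterS (flow_iota_near Du Uu) => u' Uu'.
  by rewrite /= /transport box_coordKV.
Qed.

(** * The flow acts by transverse isometries *)

Definition flow_holonomy (x : M) (t : R) (y : M) (u : 'rV[R]_2) : 'rV[R]_2 :=
  (transport x t y u).1.

Lemma flow_holonomy0 x y : flow_holonomy x 0 y = holonomy L iota eps x y.
Proof. by apply/funext => u; rewrite /flow_holonomy /transport (flow0 hL). Qed.

Lemma flow_holonomy_differentiable x t y u : D u -> U x (L t (iota y u)) ->
  differentiable (flow_holonomy x t y) u.
Proof.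
move=> Du Uu; apply: (@differentiable_comp _ _ _ _ (transport x t y) fst).
  exact: transport_differentiable.
by apply: linear_differentiable => z; exact: continuous_fst.
Qed.

(** A point z close to q lies on a short orbit arc through a point of the disk at q,
and the box at x does not distinguish the two ends of this arc. *)
Lemma box_coord_rebase x q : U x q -> \forall z \near q,
  (phi x z).1 = (phi x (iota q (phi q z).1)).1.
Proof.
move=> Uq.
pose r z := (phi x z).2 - (phi q z).2.
have cr : r @ q --> (phi x q).2.
  rewrite -[X in _ --> X]subr0 -[X in _ - X](_ : (phi q q).2 = 0); last first.
    by rewrite box_coord_self.
  apply: cvgB.
    apply: (cvg_comp (phi x) snd); last exact: continuous_snd.
    exact: box_coord_continuous.
  apply: (cvg_comp (phi q) snd); last exact: continuous_snd.
  exact/box_coord_continuous/self_flow_box.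
have [_ /andP[lo hi]] := flow_box_coord Uq.
have rlo : \forall z \near q, - eps x < r z := cr _ (lt_nbhsr lo).
have rhi : \forall z \near q, r z < eps x := cr _ (lt_nbhsl hi).
near=> z.
have Uxz : U x z by near: z; exact: flow_box_near.
have Uqz : U q z by near: z; exact/flow_box_near/self_flow_box.
have zr : - eps x < r z < eps x.
  by apply/andP; split; near: z.
have -> : iota q (phi q z).1 = L (- (phi q z).2) z.
  by rewrite -{3}(box_coordKV Uqz) /iota_tilde flowK.
by have [_ ->] := box_coord_flow Uxz zr.
Unshelve. all: by end_near. Qed.

(** The points [L s] and [L t] of one orbit differ by a motion inside the box, which
only changes the time coordinate, uniformly for the orbits near that of u. *)
Lemma flow_holonomy_time x t y u : D u -> U x (L t (iota y u)) ->
  \forall s \near t, U x (L s (iota y u)) /\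
    \forall u' \near u, flow_holonomy x t y u' = flow_holonomy x s y u'.
Proof.
move=> Du Uu; have [_ /andP[lo hi]] := flow_box_coord Uu.
have ctr := transport_continuous Du Uu.
have ctr2 : (fun u' => (transport x t y u').2) @ u --> (transport x t y u).2.
  by apply: (cvg_comp (transport x t y) snd); [exact: ctr|exact: continuous_snd].
set b := (phi x (L t (iota y u))).2 in lo hi.
pose d := Num.min (b + eps x) (eps x - b) / 2.
have d0 : 0 < d by rewrite divr_gt0// lt_min; apply/andP; split; lra.
have dlo : d * 2 <= b + eps x by rewrite divfK// ge_min lexx.
have dhi : d * 2 <= eps x - b by rewrite divfK// ge_min lexx orbT.
have nearu : \forall u' \near u, U x (L t (iota y u')) /\
    `|b - (transport x t y u').2| < d.
  near=> u'; split; near: u'; first exact: flow_iota_near.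
  by move/cvgrPdist_lt : ctr2; apply.
near=> s.
have st : `|t - s| < d.
  by near: s; move: (@cvg_id _ (nbhs t)) => /cvgrPdist_lt; apply.
have shift u' : U x (L t (iota y u')) /\ `|b - (transport x t y u').2| < d ->
    U x (L s (iota y u')) /\ flow_holonomy x t y u' = flow_holonomy x s y u'.
  move=> [Uu' bu'].
  have LE : L s (iota y u') = L (s - t) (L t (iota y u')).
    by rewrite -(flowD hL) subrK.
  have [] := @box_coord_flow x (L t (iota y u')) (s - t) Uu'.
    move: st bu'; rewrite /transport !ltr_norml => /andP[? ?] /andP[? ?].
    by apply/andP; split; lra.
  by rewrite /flow_holonomy /transport LE => ? ->.
split; first by apply: (shift u _).1; exact: nbhs_singleton nearu.
by apply: filterS nearu => u' /shift[].
Unshelve. all: by end_near. Qed.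

Context (g : 'rV[R]_2 -> 'M[R]_2) (hinv : holonomy_invariant L iota eps g).

Lemma holonomy_isometric x y u v : D u -> U x (iota y u) ->
  metric_sq g (flow_holonomy x 0 y u) ('d (flow_holonomy x 0 y) u v) =
  metric_sq g u v.
Proof.
by move=> Du Uu; rewrite flow_holonomy0 /metric_sq hinv.
Qed.

Let speed x t y u v :=
  metric_sq g (flow_holonomy x t y u) ('d (flow_holonomy x t y) u v).

(** The pseudo-group directly relates the box at x only to a disk that meets it; the
disk through the endpoint q meets every box that contains q. Reading the transport
at x instead of q composes it with the isometry from the disk at q. *)
Lemma speed_rebase x t y u v : D u -> U x (L t (iota y u)) ->
  speed x t y u v = speed (L t (iota y u)) t y u v.
Proof.
move=> Du Uu; set q := L t (iota y u).
have Uq : U q q by exact: self_flow_box.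
have hE : \forall u' \near u,
    (flow_holonomy x 0 q \o flow_holonomy q t y) u' = flow_holonomy x t y u'.
  have nq : \forall u' \near u, (phi x (L t (iota y u'))).1 =
     (phi x (iota q (phi q (L t (iota y u'))).1)).1.
    have := flow_continuous (box_coord_rebase Uu).
    exact: (iota_continuous Du).
  by apply: filterS nq => u' h; rewrite /= /flow_holonomy /transport (flow0 hL) -h.
have hq0 : flow_holonomy q t y u = 0.
  by rewrite /flow_holonomy /transport -/q box_coord_self.
have dq := @flow_holonomy_differentiable q t y u Du Uq.
have Uq0 : U x (iota q 0) by rewrite iota0.
have dx : differentiable (flow_holonomy x 0 q) (flow_holonomy q t y u).
  rewrite hq0; apply: flow_holonomy_differentiable; first exact: disk0.
  by rewrite (flow0 hL).
have dqx := differentiable_comp dq dx.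
have [_ dE] := near_eq_is_diff hE dqx.
have hu : flow_holonomy x 0 q (flow_holonomy q t y u) = flow_holonomy x t y u.
  exact: nbhs_singleton hE.
have dqv := congr1 (fun f => f v) (etrans dE (diff_comp dq dx)).
have iso := holonomy_isometric ('d (flow_holonomy q t y) u v) disk0 Uq0.
transitivity (metric_sq g (flow_holonomy x 0 q (flow_holonomy q t y u))
  ('d (flow_holonomy x 0 q) (flow_holonomy q t y u)
    ('d (flow_holonomy q t y) u v))).
  exact: (f_equal2 (metric_sq g) (esym (nbhs_singleton hE)) dqv).
by rewrite /speed hq0.
Qed.

(** Invariance under the pseudo-group propagates along orbits: read in the disk at
the moving endpoint, the speed is a locally constant function of the time, hence
constant, and at time 0 it belongs to an element of the pseudo-group. *)
Lemma flow_holonomy_isometric x t y u v : D u -> U x (L t (iota y u)) ->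
  metric_sq g (flow_holonomy x t y u) ('d (flow_holonomy x t y) u v) =
  metric_sq g u v.
Proof.
move=> Du Uu; rewrite -/(speed x t y u v) (speed_rebase _ Du Uu).
pose f (s : R) : R := speed (L s (iota y u)) s y u v.
have fcst s : \forall s' \near s, cst (f s) s' = f s'.
  have Us := self_flow_box (L s (iota y u)).
  apply: filterS (flow_holonomy_time Du Us) => s' [Us' hE].
  have [_ dE] := near_eq_is_diff hE (flow_holonomy_differentiable Du Us).
  transitivity (speed (L s (iota y u)) s' y u v); last exact: speed_rebase.
  exact: (f_equal2 (metric_sq g) (nbhs_singleton hE)
    (congr1 (fun h => h v) (esym dE))).
have fder s : is_derive s (1 : R) f 0.
  have := is_derive_cst (f s) s 1.
  apply: near_eq_is_derive.
  exact: fcst.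
rewrite -/(f t) (is_derive_0_is_cst t 0 fder) /f.
rewrite /speed holonomy_isometric//.
by rewrite (flow0 hL); exact: self_flow_box.
Qed.

(** * Transverse displacements tolerated by a flow step *)

(** The radius 1/4 leaves room for displacements up to 1/4, since sup-norm balls of
radius 1/2 lie in the unit disk. *)
Definition core (x : M) : set ('rV[R]_2 * R) :=
  [set z | `|z.1| <= 1 / 4 /\ `|z.2| <= eps x / 2].

Lemma half_ball_disk (u : 'rV[R]_2) : `|u| <= 1 / 2 -> D u.
Proof.
move=> u2; rewrite /unit_disk /=.
have h j : u 0 j ^+ 2 <= 1 / 4.
  have := le_trans (coord_norm_le u j) u2.
  rewrite -real_normK ?num_real// => uj.
  by have := normr_ge0 (u 0 j); nra.
have := h 0; have := h 1; lra.
Qed.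

Lemma core_box x z : core x z -> B x z.
Proof.
move=> [z1 z2]; split; first by apply: half_ball_disk; lra.
by move: z2 (eps_gt0 x); rewrite ler_norml => /andP[? ?] ?; apply/andP; split; lra.
Qed.

Lemma core_compact x : compact (core x).
Proof.
apply: (@compact_setX _ _ [set v : 'rV[R]_2 | `|v| <= 1 / 4]
  [set r : R | `|r| <= eps x / 2]).
  exact: closed_ball_rV_compact.
rewrite (_ : [set r : R | _] = `[- (eps x / 2), eps x / 2]%classic).
  exact: segment_compact.
by apply/seteqP; split => r /=; rewrite in_itv/= ler_norml.
Qed.

Lemma core_image_compact x : compact (T x @` core x).
Proof.
apply: continuous_compact; last exact: core_compact.
apply: continuous_in_subspaceT => z /set_mem cz.
exact/iota_tilde_continuous/core_box.
Qed.

Lemma core_image_nbhs x : nbhs x (T x @` core x).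
Proof.
have Ux := self_flow_box x.
have cx := box_coord_continuous Ux.
have c1 : (fun q => (phi x q).1) @ x --> (0 : 'rV[R]_2).
  have -> : (0 : 'rV[R]_2) = (phi x x).1 by rewrite box_coord_self.
  by apply: (cvg_comp (phi x) fst); [exact: cx|exact: continuous_fst].
have c2 : (fun q => (phi x q).2) @ x --> (0 : R).
  have -> : (0 : R) = (phi x x).2 by rewrite box_coord_self.
  by apply: (cvg_comp (phi x) snd); [exact: cx|exact: continuous_snd].
near=> q; exists (phi x q); last first.
  by apply: box_coordKV; near: q; exact: flow_box_near.
split.
- rewrite -normrN -sub0r; near: q; move/cvgrPdist_le : c1; apply; lra.
- rewrite -normrN -sub0r; near: q; move/cvgrPdist_le : c2; apply.
  by rewrite divr_gt0// eps_gt0.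
Unshelve. all: by end_near. Qed.

Lemma finite_core_cover : compact [set: M] -> M ->
  exists s : seq M, forall q, exists c z, [/\ c \in s, core c z & T c z = q].
Proof.
move=> cM x0.
(* The covering form of compactness is stated for pointed spaces. *)
pose pM : ptopologicalType := HB.pack (M : Type) M (isPointed.Build M x0).
have : @compact pM [set: M] by exact: cM.
rewrite compact_cover => /(_ M [set: M] (fun c => interior (T c @` core c))) [].
- by move=> c _; exact: open_interior.
- by move=> q _; exists q => //; exact: core_image_nbhs.
- move=> s _ hs; exists (finmap.enum_fset s) => q.
  have [c cs /interior_subset[z cz zq]] := hs q I.
  by exists c, z.
Qed.

(** A transverse displacement of size k is tolerated by the flow step of duration S
from the box at j to the box at i: the step started from the displaced point still
ends in the box at i, well inside of it. *)
Definition tolerates (S : R) i j (k : R) (z : 'rV[R]_2 * R) :=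
  (T i @` core i) (L S (T j z)) -> forall w : 'rV[R]_2, `|w - z.1| < k ->
    U i (L S (T j (w, z.2))) /\ `|(phi i (L S (T j (w, z.2)))).1| <= 1 / 2.

(** Tolerance is an open condition at each point of the compact core: near a point
whose step hits the closed core at i by continuity, near the others vacuously. *)
Lemma uniform_step S i j : hausdorff_space M ->
  \forall k \near 0^'+, core j `<=` tolerates S i j k.
Proof.
move=> hM; have /compact_near_coveringP cov := @core_compact j.
apply: cov => z cz.
have cT : {for z, continuous (fun z => L S (T j z))}.
  apply: (cvg_comp (T j) (L S)); last exact: flow_continuous.
  exact/iota_tilde_continuous/core_box.
have [|nhit] := pselect ((T i @` core i) (L S (T j z))); last first.
  have nclosed : nbhs (L S (T j z)) (~` (T i @` core i)).
    apply: open_nbhs_nbhs; split => //; apply: closed_openC.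
    by apply: (compact_closed hM); exact: core_image_compact.
  have away : \forall z' \near z, ~ (T i @` core i) (L S (T j z')) := cT _ nclosed.
  exists ([set z' | ~ (T i @` core i) (L S (T j z'))], setT) => /=.
    by split => //; exact: filterT.
  by move=> [z' k] /= [h _] /h.
move=> [z0 cz0 z0E].
have Uz : U i (L S (T j z)) by rewrite -z0E; exists z0 => //; exact: core_box.
have cphi : (fun z' => (phi i (L S (T j z'))).1) @ z --> z0.1.
  have -> : z0.1 = (phi i (L S (T j z))).1.
    by rewrite -z0E box_coordK//; exact: core_box.
  apply: (cvg_comp (fun z' => L S (T j z')) (fun q => (phi i q).1)).
    exact: cT.
  apply: (cvg_comp (phi i) fst); last exact: continuous_fst.
  exact: box_coord_continuous.
have near1 : \forall z' \near z, U i (L S (T j z')) := cT _ (flow_box_near Uz).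
have near2 : \forall z' \near z, `|(phi i (L S (T j z'))).1| <= 1 / 2.
  move/cvgrPdist_le : cphi => /(_ (1 / 4)) h.
  have : \forall z' \near z, `|z0.1 - (phi i (L S (T j z'))).1| <= 1 / 4.
    by apply: h; lra.
  apply: filterS => z'; have [z01 _] := cz0.
  have := lerB_dist (phi i (L S (T j z'))).1 z0.1; rewrite distrC; lra.
have [d /= d0 dP] := (nbhs_ballP _ _).1 (filterI near1 near2).
exists (ball z (d / 2), [set k | k < d / 2]) => /=.
  split; first by apply: nbhsx_ballx; rewrite divr_gt0.
  by apply: nbhs_right_lt; rewrite divr_gt0.
move=> [z' k] /= [zz' kd] _ w wz'; apply: dP.
move: zz' => [/= zz'1 zz'2]; split => /=; last by apply: le_ball zz'2; lra.
move: zz'1; rewrite -!ball_normE /= => zz'1.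
by have := ler_distD z'.1 z.1 w; rewrite (distrC z'.1 w); lra.
Qed.

Lemma uniform_steps S (s : seq M) : hausdorff_space M ->
  exists2 k : R, 0 < k & forall i j, i \in s -> j \in s ->
    core j `<=` tolerates S i j k.
Proof.
move=> hM.
have : \forall k \near (0 : R)^'+, forall i j : seq_sub s,
    core (ssval j) `<=` tolerates S (ssval i) (ssval j) k.
  apply: filter_forall => i; apply: filter_forall => j; exact: uniform_step.
move=> h; have [k [k0 kP]] := filter_ex (filterI (nbhs_right_gt (0:R)) h).
by exists k => // i j is_ js; exact: (kP (SeqSub is_) (SeqSub js)).
Qed.

(** * Equicontinuity of the holonomy *)

Context (hg : riemannian_metric D g).

Let norm_ball (w0 : 'rV[R]_2) (r : R) : set 'rV[R]_2 :=
  [set v : 'rV[R]_2 | `|v - w0| < r].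

(** H is an extension of the holonomy along one orbit, from the disk at y to the disk
at i, to a whole ball of the disk at y. Neighbouring orbits need different times to
reach the disk at i, whence a time tau that depends on the point; b keeps it under
control. The bound 1/2 makes the image lie in the compact part of the disk on which
the metric is comparable with the norm. *)
Record pullback (y i : M) (w0 : 'rV[R]_2) (r b : R)
    (H : 'rV[R]_2 -> 'rV[R]_2) (tau : 'rV[R]_2 -> R) : Prop := Pullback {
  pullback_half : forall v : 'rV[R]_2, norm_ball w0 r v -> `|H v| <= 1 / 2 ;
  pullback_flow : forall v : 'rV[R]_2, norm_ball w0 r v ->
    iota i (H v) = L (tau v) (iota y v) ;
  pullback_cont : forall v : 'rV[R]_2, norm_ball w0 r v -> {for v, continuous H} ;
  pullback_tau_cont : forall v : 'rV[R]_2, norm_ball w0 r v ->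
    {for v, continuous tau} ;
  pullback_tau_bound : forall v : 'rV[R]_2, norm_ball w0 r v -> `|tau v| <= b
}.

Lemma norm_ball_near w0 r v :
  norm_ball w0 r v -> \forall v' \near v, norm_ball w0 r v'.
Proof.
move=> hv; apply/(nbhs_ballP v); exists (r - `|v - w0|).
  by rewrite /= subr_gt0.
move=> v'; rewrite -ball_normE /norm_ball /= => h.
have := ler_distD v v' w0; rewrite (distrC v' v); lra.
Qed.

(** Freezing the time at v changes the extended holonomy only along the orbits, so
that near v it is the transport by a flow map. *)
Lemma pullback_holonomy y i w0 r b H tau v :
  pullback y i w0 r b H tau -> norm_ball w0 r v ->
  U i (L (tau v) (iota y v)) /\
  \forall v' \near v, flow_holonomy i (tau v) y v' = H v'.
Proof.
move=> P hv; have Pflow := pullback_flow P.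
split.
  rewrite -Pflow//; exact: iota_flow_box (half_ball_disk (pullback_half P hv)).
have tnear : \forall v' \near v, `|tau v - tau v'| < eps i.
  by have /cvgrPdist_lt := pullback_tau_cont P hv; apply; exact: eps_gt0.
have bnear := norm_ball_near hv.
apply: filterS2 tnear bnear => v' tv' bv'.
rewrite /flow_holonomy /transport.
have -> : L (tau v) (iota y v') = T i (H v', tau v - tau v').
  by rewrite /iota_tilde /= Pflow// -(flowD hL) subrK.
rewrite box_coordK//; split; first exact: half_ball_disk (pullback_half P bv').
by rewrite -ltr_norml.
Qed.

(** The constant is independent of b, that is, of how long the orbits are followed:
this is the equicontinuity of the holonomy. *)
Lemma pullback_lipschitz : exists2 K : R, 0 <= K &
  forall y i w0 r b H tau, pullback y i w0 r b H tau ->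
    `|w0| + r <= 1 / 2 ->
    forall v v', norm_ball w0 r v -> norm_ball w0 r v' ->
      `|H v' - H v| <= K * `|v' - v|.
Proof.
have [K [K0 KP]] := isometry_bound (@closed_ball_rV_compact R 2 (1 / 2))
  half_ball_disk hg.
exists K => // y i w0 r b H tau P wr v v' bv bv'.
apply: mean_value; first by rewrite mulr_ge0.
move=> s s01.
set u := v + s *: (v' - v).
have bu : norm_ball w0 r u.
  have uE : u - w0 = (1 - s) *: (v - w0) + s *: (v' - w0).
    rewrite scalerBl scale1r -[RHS]addrA (addrC (- (s *: _))) -scalerBr.
    rewrite opprB addrA subrK.
    by rewrite /u addrAC.
  move: s01 bv bv' => /andP[s0 s1]; rewrite /norm_ball /= uE => bv bv'.
  apply: (le_lt_trans (ler_normD _ _)).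
  rewrite !normrZ (ger0_norm s0) ger0_norm ?subr_ge0//.
  apply: (@le_lt_trans _ _ (Num.max `|v - w0| `|v' - w0|)); last first.
    by rewrite gt_max bv.
  have h1 : `|v - w0| <= Num.max `|v - w0| `|v' - w0| by rewrite le_max lexx.
  have h2 : `|v' - w0| <= Num.max `|v - w0| `|v' - w0| by rewrite le_max lexx orbT.
  have := ler_wpM2l s0 h2.
  have s1' : 0 <= 1 - s by rewrite subr_ge0.
  have := ler_wpM2l s1' h1; lra.
have u2 : `|u| <= 1 / 2.
  have := lerB_dist u w0; move: bu; rewrite /norm_ball /=; lra.
have Du := half_ball_disk u2.
have [Uu hE] := pullback_holonomy P bu.
have dh := flow_holonomy_differentiable Du Uu.
have [dH dE] := near_eq_is_diff hE dh.
split; first exact: dH.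
have iso := flow_holonomy_isometric (v' - v) Du Uu.
have HE := f_equal2 (metric_sq g) (nbhs_singleton hE)
  (congr1 (fun f => f (v' - v)) (esym dE)).
exact: (KP _ _ _ _ u2 (pullback_half P bu) (etrans (esym HE) iso)).
Qed.

Lemma pullback_step y i i' w0 r b H tau S (k s : R) z' :
  pullback y i w0 r b H tau ->
  (forall v, norm_ball w0 r v -> `|H v - H w0| < k) -> 0 < r ->
  core i (H w0, s) -> tolerates S i' i k (H w0, s) ->
  core i' z' -> T i' z' = L S (T i (H w0, s)) ->
  exists H' tau', pullback y i' w0 r (b + `|S| + eps i + eps i') H' tau' /\
    H' w0 = z'.1.
Proof.
move=> P Hk r0 cw tol cz' zE.
have [_ /= sB] := cw.
have sB' : - eps i < s < eps i.
  move: sB (eps_gt0 i); rewrite ler_norml => /andP[? ?] ?.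
  by apply/andP; split; lra.
pose q v := L S (T i (H v, s)).
have qP (v : 'rV[R]_2) : norm_ball w0 r v ->
    U i' (q v) /\ `|(phi i' (q v)).1| <= 1 / 2.
  by move=> bv; apply: tol; [exists z'|exact: Hk].
have qc (v : 'rV[R]_2) : norm_ball w0 r v ->
    {for v, continuous (fun v => phi i' (q v))}.
  move=> bv; have [Uq _] := qP v bv.
  have h1 : {for v, continuous (fun v => (H v, s))}.
    exact: (cvg_pair (pullback_cont P bv) (@cst_continuous _ _ s v)).
  have h2 : {for (H v, s), continuous (T i)}.
    apply: iota_tilde_continuous; split => //=.
    exact: half_ball_disk (pullback_half P bv).
  have h3 : {for T i (H v, s), continuous (L S)} by exact: flow_continuous.
  have h4 : {for q v, continuous (phi i')} by exact: box_coord_continuous.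
  exact: (continuous_comp (continuous_comp (continuous_comp h1 h2) h3) h4).
(* From q v the disk at i' is reached by undoing the time coordinate of q v. *)
exists (fun v => (phi i' (q v)).1), (fun v => tau v + s + S - (phi i' (q v)).2).
split; last by rewrite /q -zE box_coordK//; exact: core_box.
split => v bv.
- by have [] := qP v bv.
- have [Uq _] := qP v bv.
  have -> : iota i' (phi i' (q v)).1 = L (- (phi i' (q v)).2) (q v).
    by rewrite -{3}(box_coordKV Uq) /iota_tilde flowK.
  rewrite /q /iota_tilde /= (pullback_flow P bv) -!(flowD hL); congr (L _ _).
  by ring.
- exact: (continuous_comp (qc v bv) (@continuous_fst _ _ _)).
- have h1 : {for v, continuous (fun v => tau v + s)}.
    exact: (continuousD (pullback_tau_cont P bv) (@cst_continuous _ _ s v)).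
  have h2 : {for v, continuous (fun v => tau v + s + S)}.
    exact: (continuousD h1 (@cst_continuous _ _ S v)).
  have h3 : {for v, continuous (fun v => (phi i' (q v)).2)}.
    exact: (continuous_comp (qc v bv) (@continuous_snd _ _ _)).
  exact: (continuousB h2 h3).
- have [Uq _] := qP v bv; have [_] := flow_box_coord Uq.
  rewrite -ltr_norml => h2.
  have h1 := pullback_tau_bound P bv.
  have h3 := ler_normB (tau v + s + S) (phi i' (q v)).2.
  have h4 := ler_normD (tau v + s) S; have h5 := ler_normD (tau v) s.
  have := eps_gt0 i; move: sB => /=; lra.
Qed.

Lemma pullback_id y w0 r : `|w0| + r <= 1 / 2 ->
  pullback y y w0 r 0 id (fun=> 0).
Proof.
move=> wr; split => v bv.
- by have := lerB_dist v w0; move: bv; rewrite /norm_ball /=; lra.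
- by rewrite (flow0 hL).
- exact: cvg_id.
- exact: (@cst_continuous _ _ (0 : R) v).
- by rewrite normr0.
Qed.

(** The Lipschitz constant K does not deteriorate from step to step, so a ball of
radius r with K r below the tolerance k survives every number of steps. *)
Lemma pullback_chain (s : seq M) (S : R) : hausdorff_space M ->
  exists r K b : R, [/\ 0 < r, 0 <= K & forall (c : nat -> M) z,
    (forall n, c n \in s) -> (forall n, core (c n) (z n)) ->
    (forall n, T (c n) (z n) = L S (T (c n.+1) (z n.+1))) ->
    forall l n, exists H tau,
      pullback (c (n + l)%N) (c n) (z (n + l)%N).1 r (l%:R * b) H tau /\
      forall v, `|v - (z (n + l)%N).1| < r ->
        `|H v - (z n).1| <= K * `|v - (z (n + l)%N).1|].
Proof.
move=> hM.
have [k k0 kP] := uniform_steps S s hM.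
have [K K0 KP] := pullback_lipschitz.
pose r := Num.min (1 / 4) (k / (K + 1)).
have K1 : 0 < K + 1 by lra.
have r0 : 0 < r by rewrite lt_min; apply/andP; split; [lra|exact: divr_gt0].
have r4 : r <= 1 / 4 by rewrite ge_min lexx.
have Kr : K * r < k.
  have : r * (K + 1) <= k by rewrite -ler_pdivlMr// ge_min lexx orbT.
  by nra.
pose E := \big[Num.max/0]_(i <- s) eps i.
have epsE i : i \in s -> eps i <= E by move=> si; exact: le_bigmax_seq.
exists r, K, (`|S| + 2 * E); split => // c z cs cz zE.
have cr n : `|(z n).1| + r <= 1 / 2 by have [] := cz n; lra.
have main l : forall n, exists H tau,
    pullback (c (n + l)%N) (c n) (z (n + l)%N).1 r (l%:R * (`|S| + 2 * E)) H tau /\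
    H (z (n + l)%N).1 = (z n).1.
  elim: l => [|l IHl] n.
    by rewrite addn0 mul0r; exists id, (fun=> 0); split => //; exact: pullback_id.
  have [H [tau]] := IHl n.+1; rewrite addSnnS => -[P Hz].
  set w0 := (z (n + l.+1)%N).1 in P Hz *.
  have Hk v : norm_ball w0 r v -> `|H v - H w0| < k.
    move=> bv; apply: le_lt_trans Kr.
    have bw : norm_ball w0 r w0 by rewrite /norm_ball /= subrr normr0.
    apply: (le_trans (KP _ _ _ _ _ _ _ P (cr _) _ _ bw bv)).
    by rewrite ler_wpM2l//; exact: ltW.
  have zS : (H w0, (z n.+1).2) = z n.+1 by rewrite Hz -surjective_pairing.
  have := @pullback_step _ _ (c n) _ _ _ _ _ S k (z n.+1).2 (z n) P Hk r0.
  rewrite zS => /(_ (cz _) (kP _ _ (cs _) (cs _) _ (cz _)) (cz _) (zE _)).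
  move=> [H' [tau' [P' Hz']]]; exists H', tau'; split => //.
  case: P' => P1 P2 P3 P4 P5; split => // v bv.
  apply: (le_trans (P5 v bv)); rewrite -natr1.
  have := epsE _ (cs n); have := epsE _ (cs n.+1); lra.
move=> l n; have [H [tau [P Hz]]] := main l n; exists H, tau; split => // v bv.
rewrite -Hz; apply: (KP _ _ _ _ _ _ _ P (cr _)) => //.
by rewrite /norm_ball /= subrr normr0.
Qed.

(** * Return of the orbits *)

(** Sample the orbit of x at the times [e * n]. By pigeonhole a sample m comes back,
transversally, close to an earlier sample k. Flowing back from k to 0 brings the
sample k to x and, by equicontinuity, the sample m to a point close to x of the disk
at x; this point is on the orbit of x, at a time that differs from [e * m] by an
amount depending on k only, and m is arbitrarily large. *)
Lemma orbit_return (e : R) (x : M) (rho t0 : R) :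
  compact [set: M] -> hausdorff_space M -> e * e = 1 -> 0 < rho ->
  exists t v, [/\ t0 <= t, `|v| < rho & L (e * t) x = iota x v].
Proof.
move=> cM hM ee rho0.
have [s0 s0P] := finite_core_cover cM x.
pose s := x :: s0.
have core0 : core x (0, 0).
  by split => /=; rewrite normr0 ?divr_ge0// ltW// eps_gt0.
have /choice[cz czP] : forall n : nat, exists cz : M * ('rV[R]_2 * R),
    [/\ cz.1 \in s, core cz.1 cz.2, T cz.1 cz.2 = L (e * n%:R) x &
        n = 0%N -> cz = (x, (0, 0))].
  case=> [|n].
    exists (x, (0, 0)); split => //=; first exact: mem_head.
    by rewrite iota_tilde0 mulr0 (flow0 hL) iota0.
  have [c [z [cs0 coz zE]]] := s0P (L (e * n.+1%:R) x).
  by exists (c, z); split => //; rewrite inE cs0 orbT.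
(* The chain starts at x in the box at x, so that the backward chain ends there. *)
pose c n := (cz n).1; pose z n := (cz n).2.
have cs n : c n \in s by case: (czP n).
have coz n : core (c n) (z n) by case: (czP n).
have zE n : T (c n) (z n) = L (e * n%:R) x by case: (czP n).
have [r [K [b [r0 K0 rKb]]]] := pullback_chain s (- e) hM.
pose d := Num.min r (rho / (K + 1)).
have K1 : 0 < K + 1 by lra.
have d0 : 0 < d by rewrite lt_min r0 divr_gt0.
have [k kP] := labelled_pigeonhole d0 cs (fun n => (coz n).1).
have [|H [tau [P Hlip]]] := rKb c z cs coz _ k 0%N.
  by move=> n; rewrite !zE -(flowD hL) -natr1; congr (L _ x); ring.
rewrite add0n in P Hlip.
have c0 : c 0%N = x by rewrite /c; case: (czP 0%N) => _ _ _ ->.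
have z0 : (z 0%N).1 = 0 by rewrite /z; case: (czP 0%N) => _ _ _ ->.
pose B := `|t0| + `|k%:R * b| + eps (c k).
have B0 : 0 <= B by rewrite !addr_ge0// ltW// eps_gt0.
have [m [km cm wm]] := kP (Num.bound B).
have mB : B < m%:R.
  by apply: (lt_le_trans (archi_boundP B0)); rewrite ler_nat.
have wr : `|(z m).1 - (z k).1| < r.
  by apply: (lt_le_trans wm); rewrite ge_min lexx.
exists (e * (tau (z m).1 - (z m).2) + m%:R), (H (z m).1); split.
- have h1 : `|tau (z m).1| <= k%:R * b := pullback_tau_bound P wr.
  have [_ h2] := coz m; rewrite cm in h2.
  have e1 : `|e| = 1.
    by apply/eqP; rewrite -(@eqrXn2 _ 2%N)// -normrX expr2 ee normr1 expr1n.
  have h3 : `|e * (tau (z m).1 - (z m).2)| <= k%:R * b + eps (c k) / 2.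
    rewrite normrM e1 mul1r; apply: (le_trans (ler_normB _ _)); exact: lerD.
  move: h3; rewrite ler_norml => /andP[h3 _].
  have := ler_norm t0; have := ler_norm (k%:R * b); have := eps_gt0 (c k).
  move: mB; rewrite /B; lra.
- have := Hlip _ wr; rewrite z0 subr0 => /le_lt_trans; apply.
  have dK : d * (K + 1) <= rho.
    by rewrite -ler_pdivlMr// ge_min lexx orbT.
  apply: le_lt_trans (_ : K * d < rho); first by rewrite ler_wpM2l// ltW.
  nra.
- have := pullback_flow P wr; rewrite c0 => ->.
  rewrite mulrDr mulrA ee mul1r.
  have -> : iota (c k) (z m).1 = L (- (z m).2) (T (c m) (z m)).
    by rewrite cm /iota_tilde flowK.
  by rewrite zE -!(flowD hL); congr (L _ x); ring.
Qed.

Lemma orbit_return_sequence (e : R) (x : M) :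
  compact [set: M] -> hausdorff_space M -> e * e = 1 ->
  exists t : nat -> R, t @ \oo --> +oo /\ (fun n => L (e * t n) x) @ \oo --> x.
Proof.
move=> cM hM ee.
have /choice[tv tvP] : forall n : nat, exists tv : R * 'rV[R]_2,
    [/\ n%:R <= tv.1, `|tv.2| < n.+1%:R^-1 & L (e * tv.1) x = iota x tv.2].
  move=> n; have n0 : (0 : R) < n.+1%:R^-1 by rewrite invr_gt0 ltr0n.
  by have [t [v h]] := @orbit_return e x _ n%:R cM hM ee n0; exists (t, v).
exists (fun n => (tv n).1); split.
  apply/cvgryPge => a; near=> n.
  have an : a <= n%:R by near: n; exact: nbhs_infty_ger.
  by have [h _ _] := tvP n; exact: le_trans an h.
have -> : (fun n => L (e * (tv n).1) x) = iota x \o (fun n => (tv n).2).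
  by apply/funext => n /=; have [_ _ ->] := tvP n.
have v0 : (fun n => (tv n).2) @ \oo --> (0 : 'rV[R]_2).
  apply/cvgrPdist_lt => d d0; near=> n; rewrite sub0r normrN.
  have [_ h _] := tvP n; apply: (lt_trans h).
  by near: n; exact: near_infty_natSinv_lt (PosNum d0).
rewrite -[X in _ --> X](iota0 x).
by apply: (cvg_comp _ _ v0); apply: iota_continuous; exact: disk0.
Unshelve. all: by end_near. Qed.

End FlowBoxes.

Theorem theorem1p1 (R : realType) (M : topologicalType) (A : atlas R 3 M)
    (hM : closed_connected_manifold A) (hor : oriented A)
    (X : vector_field A) (hX : nowhere_vanishing X)
    (L : R -> M -> M) (hL : is_flow X L)
    (hriem : riemannian X L) :
  forall x : M, recurrence_point L x.
Proof.
move=> x; have [hH _ cM _] := hM.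
have [iota [eps [g [hiota hg hinv]]]] := hriem.
split.
- have [t [tt tx]] := orbit_return_sequence hL hiota hinv hg x cM hH (mulr1 1).
  by exists t; split => //; under eq_fun do rewrite -[t _]mul1r.
- have [|t [tt tx]] := orbit_return_sequence hL hiota hinv hg (e := -1) x cM hH.
    by rewrite mulrNN mulr1.
  by exists t; split => //; under eq_fun do rewrite -mulN1r.
Qed.
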